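(* Let $\mathcal D$ be a size-$n$ dataset and let $\mathbf w=(w_1,\dots,w_n)$ be the first-stage optimal weights for $\mathcal D$. Assume that the objective $\mathcal L(\cdot;\mathcal D)$ is $\rho$-strongly convex for some $\rho\ge0$ (allowing $\rho=0$). Let $\theta^{\mathrm{opt}}=\arg\min_{\theta\in\Theta}\mathcal L(\theta;\mathcal D)$ and $a_0:=\|\theta^{\mathrm{opt}}\|_2$. Put $$A=\frac{2\rho+3\gamma}{2(\rho+\gamma)^2},\qquad B=\frac{a_0\gamma(\rho+3\gamma)}{(\rho+\gamma)^2},\qquad C=\frac{2a_0^2(\rho+2\gamma)}{(\rho+\gamma)^2}\gamma^2,\qquad D_t:=\frac{2(t-C)}{B+\sqrt{B^2+4A(t-C)}} .$$ Then for each $t\ge C$, $$\mathbb P_{\mathbf b}\big(\mathcal L(\theta^{\mathrm{priv}};\mathcal D)\ge\mathcal L(\theta^{\mathrm{opt}};\mathcal D)+t\big)\le\mathbb P_{\mathbf b}\big(\|\mathbf b\|_2\ge nD_t\big).$$ Moreover: (i) If $\mathbf b$ has density proportional to $\exp(-\beta\|\mathbf x\|_2)$ on $\mathbb R^p$, $\beta>0$, then for each $t\ge C$ $$\mathbb P_{\mathbf b}\big(\mathcal L(\theta^{\mathrm{priv}};\mathcal D)\ge\mathcal L(\theta^{\mathrm{opt}};\mathcal D)+t\big)\le C_p\exp\Big(-\frac{\beta nD_t}{2}\Big),$$ where $C_p:=e\big(\tfrac{2(p-1)}{e}\big)^{p-1}$ depends only on $p$ (and $C_1:=1$). (ii) If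 $\mathbf b\sim\mathcal N(\mathbf 0,\sigma^2\mathbf I_p)$, $\sigma>0$, then for each $t\ge C$ $$\mathbb P_{\mathbf b}\big(\mathcal L(\theta^{\mathrm{priv}};\mathcal D)\ge\mathcal L(\theta^{\mathrm{opt}};\mathcal D)+t\big)\le2\exp\Big(-\frac{1}{2\sigma^2}\big(nD_t-\sigma\sqrt p\big)_+^2\Big).$$
   Context: $(u)_+=\max\{u,0\}$; $n\Delta^n$ is the set of nonnegative vectors in $\mathbb R^n$ with sum $n$. $\mathbb P_{\mathbf b}$ is probability over the noise vector $\mathbf b\in\mathbb R^p$. Two-stage ERM. A size-$n$ dataset is a tuple $\mathcal D=(\mathbf d_1,\dots,\mathbf d_n)$ of records. First stage: the weights are $\mathbf w(\mathcal D)=F(\boldsymbol\lambda^*(\mathcal D))\in n\Delta^n$, where $F:\Xi\to n\Delta^n$, $\Xi$ is closed convex, and $\boldsymbol\lambda^*(\mathcal D)=\arg\min_{\boldsymbol\lambda\in\Xi}\mathcal E(\boldsymbol\lambda;\mathcal D)$ for a convex loss $\mathcal E(\cdot;\mathcal D)$. Second stage: $\Theta\subseteq\mathbb R^p$ is closed and convex, $R:\mathbb R^p\to\mathbb R$ is convex, each $\theta\mapsto\ell(\theta;\mathbf d)$ is a convex function on $\mathbb R^p$ with continuous Hessian, and $\mathcal L(\theta;\mathcal D)=\frac1n\sum_{i=1}^n w_i\ell(\theta;\mathbf d_i)+R(\theta)$. A minimizer $\theta^{\mathrm{opt}}$ of $\mathcal L(\cdot;\mathcal D)$ over $\Theta$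 is assumed to exist. Given $\gamma>0$ and the noise vector $\mathbf b$, $$\theta^{\mathrm{priv}}=\arg\min_{\theta\in\Theta}\Big[\mathcal L(\theta;\mathcal D)+\frac\gamma2\|\theta\|_2^2+\frac{\langle\mathbf b,\theta\rangle}{n}\Big].$$ *)

(* Defs.v *)
From HB Require Import structures.
From mathcomp Require Import all_boot all_order all_algebra.
From mathcomp Require Import all_classical all_reals all_analysis.

Set Implicit Arguments.
Unset Strict Implicit.
Unset Printing Implicit Defensive.

Import Order.TTheory GRing.Theory Num.Theory.
Import numFieldNormedType.Exports.

Local Open Scope classical_set_scope.
Local Open Scope ring_scope.

(* The sigma-algebra of R^n is generated by the coordinate projections, as the
   library does for tuples; it is the Borel sigma-algebra. *)
Definition measure_rV_display : measure_display.
Proof. exact. Qed.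

Section measurable_rV.
Context {R : realType} (n : nat).

Let coords : 'I_n -> 'rV[R]_n -> R := fun i x => x ord0 i.

Let rV_set0 : g_sigma_preimage coords set0.
Proof. exact: sigma_algebra0. Qed.

Let rV_setC A : g_sigma_preimage coords A -> g_sigma_preimage coords (~` A).
Proof. exact: sigma_algebraC. Qed.

Let rV_bigcup (F : _^nat) : (forall i, g_sigma_preimage coords (F i)) ->
  g_sigma_preimage coords (\bigcup_i (F i)).
Proof. exact: sigma_algebra_bigcup. Qed.

HB.instance Definition _ := @isMeasurable.Build measure_rV_display
  'rV[R]_n (g_sigma_preimage coords) rV_set0 rV_setC rV_bigcup.

End measurable_rV.

Section measurable_rV_lemmas.
Context {R : realType}.

Lemma measurable_coord n (i : 'I_n) :
  measurable_fun [set: 'rV[R]_n] (fun x : 'rV[R]_n => x ord0 i).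
Proof.
move=> _ Y mY; rewrite setTI; apply: sub_sigma_algebra => /=.
rewrite -bigcup_seq/=; exists i => /=; first by rewrite mem_index_enum.
by exists Y => //; rewrite setTI.
Qed.

Lemma measurable_fun_rV d (T : measurableType d) n (f : T -> 'rV[R]_n) :
  (forall i, measurable_fun [set: T] (fun x => f x ord0 i)) ->
  measurable_fun [set: T] f.
Proof.
move=> mf.
have pre : g_sigma_preimage (fun i => (fun v : 'rV[R]_n => v ord0 i) \o f)
    `<=` measurable.
  apply: smallest_sub; first exact: sigma_algebra_measurable.
  move=> A; rewrite -bigcup_seq => -[i _] [B mB <-].
  exact: mf.
move=> _ A mA; apply: pre; rewrite g_sigma_preimage_comp.
by exists A.
Qed.

End measurable_rV_lemmas.

Section lebesgue_rV.
Context {R : realType}.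

Definition rV_cons p (z : measurableTypeR R * 'rV[R]_p) : 'rV[R]_p.+1 :=
  row_mx (z.1)%:M z.2 : 'rV_(1 + p).

Fixpoint lebesgue_rV p : set 'rV[R]_p -> \bar R :=
  match p with
  | 0 => \d_(0 : 'rV[R]_0)
  | q.+1 => pushforward (@lebesgue_measure R \x @lebesgue_rV q)%E (@rV_cons q)
  end.

Lemma rV_consE0 p (z : measurableTypeR R * 'rV[R]_p) : rV_cons z ord0 ord0 = z.1.
Proof.
transitivity (row_mx (z.1)%:M z.2 ord0 (lshift p (ord0 : 'I_1))).
  by congr fun_of_matrix; exact/val_inj.
by rewrite row_mxEl mxE eqxx mulr1n.
Qed.

Lemma rV_consES p (z : measurableTypeR R * 'rV[R]_p) (i : 'I_p) :
  rV_cons z ord0 (lift ord0 i) = z.2 ord0 i.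
Proof.
transitivity (row_mx (z.1)%:M z.2 ord0 (rshift 1 i)).
  by congr fun_of_matrix; exact/val_inj.
by rewrite row_mxEr.
Qed.

Lemma measurable_rV_cons p : measurable_fun setT (@rV_cons p).
Proof.
apply: measurable_fun_rV => i; case: (unliftP ord0 i) => [j|] ->.
  under eq_fun do rewrite rV_consES.
  exact: (measurableT_comp (measurable_coord j)).
by under eq_fun do rewrite rV_consE0; exact: measurable_fst.
Qed.

Lemma rV_cons_surj p (v : 'rV[R]_p.+1) :
  rV_cons (v ord0 ord0 : measurableTypeR R, \row_i v ord0 (lift ord0 i)) = v.
Proof.
apply/rowP => i; case: (unliftP ord0 i) => [j|] ->.
  by rewrite rV_consES mxE.
by rewrite rV_consE0.
Qed.

Let sigma_finite_cons p (S : {sigma_finite_measure set 'rV[R]_p -> \bar R})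
    (mu := pushforward (@lebesgue_measure R \x S)%E (@rV_cons p)) :
  [/\ mu set0 = 0%E, forall A, (0 <= mu A)%E,
  semi_sigma_additive mu & sigma_finite setT mu].
Proof.
pose N := product_measure1 (@lebesgue_measure R) S.
have mc := @measurable_rV_cons p.
pose L : {measure set 'rV[R]_p.+1 -> \bar R} := pushforward N (@rV_cons p).
have -> : mu = L mc by [].
split; [exact: measure0|by move=> A; exact: measure_ge0| |].
  exact: measure_semi_sigma_additive.
have [F FT Ffin] : sigma_finite setT N.
  have /sigma_finiteP[F [TF ndF Foo]] := sigma_finiteT (@lebesgue_measure R).
  have /sigma_finiteP[G [TG ndG Goo]] := sigma_finiteT S.
  exists (fun n => F n `*` G n).
    rewrite -setXTT TF TG predeqE => -[x y]; split.
      move=> [/= [n _ Fnx] [k _ Gky]]; exists (maxn n k) => //; split.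
      - by move: x Fnx; exact/subsetPset/ndF/leq_maxl.
      - by move: y Gky; exact/subsetPset/ndG/leq_maxr.
    by move=> [n _ []/= ? ?]; split; exists n.
  move=> k; have [? ?] := Foo k; have [? ?] := Goo k.
  split; first exact: measurableX.
  by rewrite [ltLHS]product_measure1E// lte_mul_pinfty// ge0_fin_numE.
pose g (v : 'rV[R]_p.+1) : measurableTypeR R * 'rV[R]_p :=
  (v ord0 ord0 : measurableTypeR R, \row_i v ord0 (lift ord0 i)).
have mg : measurable_fun setT g.
  apply: measurable_fun_pair; first exact: measurable_coord.
  apply: measurable_fun_rV => i.
  under eq_fun do rewrite mxE.
  exact: measurable_coord.
have consK : cancel (@rV_cons p) g.
  move=> [x v]; rewrite /g rV_consE0; congr pair.
  by apply/rowP => i; rewrite mxE rV_consES.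
exists (fun n => g @^-1` F n).
  by rewrite -preimage_bigcup -FT preimage_setT.
move=> n; have [mF Foo] := Ffin n; split.
  by rewrite -[X in measurable X]setTI; exact: mg.
rewrite /L /= /pushforward -comp_preimage.
by rewrite (_ : g \o _ = idfun)//; apply/funext => z /=; exact: consK.
Qed.

Let lebesgue_rV_axioms p : [/\ lebesgue_rV (set0 : set 'rV[R]_p) = 0%E,
  forall A : set 'rV[R]_p, (0 <= lebesgue_rV A)%E,
  semi_sigma_additive (@lebesgue_rV p) & sigma_finite setT (@lebesgue_rV p)].
Proof.
elim: p => [|p [m0 mge0 madd mfin]].
  split=> [|A||]; [exact: measure0|exact: measure_ge0| |exact: sigma_finiteT].
  exact: measure_semi_sigma_additive.
pose M1 := isMeasure.Build _ _ _ (@lebesgue_rV p) m0 mge0 madd.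
pose M : {measure set 'rV[R]_p -> \bar R} := HB.pack (@lebesgue_rV p) M1.
pose S1 := @Measure_isSigmaFinite.Build _ _ _ M mfin.
exact: (sigma_finite_cons (HB.pack (@lebesgue_rV p) M1 S1)).
Qed.

Let lebesgue_rV0 p : @lebesgue_rV p set0 = 0%E.
Proof. by have [] := lebesgue_rV_axioms p. Qed.

Let lebesgue_rV_ge0 p A : (0 <= @lebesgue_rV p A)%E.
Proof. by have [_ + _ _] := lebesgue_rV_axioms p; exact. Qed.

Let lebesgue_rV_sigma_additive p : semi_sigma_additive (@lebesgue_rV p).
Proof. by have [] := lebesgue_rV_axioms p. Qed.

HB.instance Definition _ p := isMeasure.Build _ _ _ (@lebesgue_rV p)
  (@lebesgue_rV0 p) (@lebesgue_rV_ge0 p) (@lebesgue_rV_sigma_additive p).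

Let lebesgue_rV_sigma_finite p : sigma_finite setT (@lebesgue_rV p).
Proof. by have [] := lebesgue_rV_axioms p. Qed.

HB.instance Definition _ p := Measure_isSigmaFinite.Build _ _ _
  (@lebesgue_rV p) (@lebesgue_rV_sigma_finite p).

Lemma lebesgue_rV_box p (A : 'I_p -> set R) :
  (forall i, measurable (A i)) ->
  lebesgue_rV [set x : 'rV[R]_p | forall i, A i (x ord0 i)] =
  (\prod_(i < p) @lebesgue_measure R (A i))%E.
Proof.
elim: p A => [|p IH] A mA.
  by rewrite big_ord0 /= diracE mem_set// => -[].
have mbox : measurable [set v : 'rV[R]_p | forall i, A (lift ord0 i) (v ord0 i)].
  rewrite (_ : [set v | _] = \bigcap_(i in [set: 'I_p])
      ((fun v : 'rV[R]_p => v ord0 i) @^-1` A (lift ord0 i))).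
    apply: fin_bigcap_measurable => // i _.
    by rewrite -[X in measurable X]setTI; exact: measurable_coord.
  by apply/seteqP; split=> [v Av i _|v Av i]; exact: Av.
rewrite /= /pushforward big_ord_recl -IH//.
transitivity ((@lebesgue_measure R \x @lebesgue_rV p)%E
    (A ord0 `*` [set v : 'rV[R]_p | forall i, A (lift ord0 i) (v ord0 i)]));
  last by rewrite [LHS]product_measure1E//; exact: mA.
congr product_measure1.
apply/seteqP; split=> [[x v] /= H|[x v] /= [Ax Av] i].
  split; first by have := H ord0; rewrite rV_consE0.
  by move=> i; have := H (lift ord0 i); rewrite rV_consES.
by case: (unliftP ord0 i) => [j|] ->; rewrite ?rV_consES ?rV_consE0.
Qed.

End lebesgue_rV.
Arguments lebesgue_rV {R} p.

Section euclidean.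
Context {R : realType} {n : nat}.
Implicit Types x y : 'rV[R]_n.

Definition dot x y : R := \sum_(i < n) x ord0 i * y ord0 i.

(* The norm `|x| of the library on row vectors is the sup norm. *)
Definition norm2 x : R := Num.sqrt (\sum_(i < n) x ord0 i ^+ 2).

Definition scaled_simplex : set 'rV[R]_n :=
  [set w | (forall i, 0 <= w ord0 i) /\ \sum_(i < n) w ord0 i = n%:R].

Definition strongly_convex (rho : R) (f : 'rV[R]_n -> R) :=
  forall (t : R) x y, 0 <= t <= 1 ->
    f (t *: x + (1 - t) *: y) <=
    t * f x + (1 - t) * f y - rho / 2 * (t * (1 - t)) * norm2 (x - y) ^+ 2.

Definition partial (i : 'I_n) (f : 'rV[R]_n -> R) : 'rV[R]_n -> R :=
  'D_(delta_mx ord0 i) f.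

Definition hessian (f : 'rV[R]_n -> R) (x : 'rV[R]_n) : 'M[R]_n :=
  \matrix_(i, j) partial i (partial j f) x.

Definition continuous_hessian (f : 'rV[R]_n -> R) :=
  [/\ forall x, differentiable f x,
      forall i x, differentiable (partial i f) x &
      continuous (hessian f)].

End euclidean.
Arguments scaled_simplex R n : clear implicits.

Definition argmin (R : realType) (T : Type) (A : set T) (f : T -> R) : set T :=
  [set x | A x /\ forall y, A y -> f x <= f y].

Section private_erm.
Context {R : realType} {X : Type} {n p : nat}.

Definition erm_objective (ell : 'rV[R]_p -> X -> R) (reg : 'rV[R]_p -> R)
    (w : 'rV[R]_n) (D : n.-tuple X) (theta : 'rV[R]_p) : R :=
  n%:R^-1 * (\sum_(i < n) w ord0 i * ell theta (tnth D i)) + reg theta.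

Definition perturbed_objective (L : 'rV[R]_p -> R) (gamma : R) (b : 'rV[R]_p)
    (theta : 'rV[R]_p) : R :=
  L theta + gamma / 2 * norm2 theta ^+ 2 + dot b theta / n%:R.

End private_erm.
Arguments perturbed_objective {R} n {p}.

(* For convex Theta, L and gamma > 0 the set of minimizers has at most one element;
   0 is only the default value of [xget], taken when it is empty. *)
Definition private_minimizer (R : realType) (n p : nat) (Theta : set 'rV[R]_p)
    (L : 'rV[R]_p -> R) (gamma : R) (b : 'rV[R]_p) : 'rV[R]_p :=
  xget 0 (argmin Theta (perturbed_objective n L gamma b)).

Section noise.
Context {R : realType} {p : nat}.

Definition has_density d (Om : measurableType d) (P : probability Om R)
    (b : {RV P >-> 'rV[R]_p}) (g : 'rV[R]_p -> R) :=
  forall A : set 'rV[R]_p, measurable A ->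
    distribution P b A = (\int[lebesgue_rV p]_(x in A) (g x)%:E)%E.

Definition has_density_propto d (Om : measurableType d) (P : probability Om R)
    (b : {RV P >-> 'rV[R]_p}) (g : 'rV[R]_p -> R) :=
  exists2 c : R, 0 < c & has_density b (fun x => c * g x).

Definition gaussian_pdf (sigma : R) (x : 'rV[R]_p) : R :=
  (Num.sqrt (2 * pi * sigma ^+ 2)) ^- p *
  expR (- (norm2 x ^+ 2 / (2 * sigma ^+ 2))).

End noise.

Section constants.
Context {R : realType}.
Implicit Types rho gamma a t : R.

Definition bound_A rho gamma : R :=
  (2 * rho + 3 * gamma) / (2 * (rho + gamma) ^+ 2).

Definition bound_B rho gamma a : R :=
  a * gamma * (rho + 3 * gamma) / (rho + gamma) ^+ 2.

Definition bound_C rho gamma a : R :=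
  2 * a ^+ 2 * (rho + 2 * gamma) / (rho + gamma) ^+ 2 * gamma ^+ 2.

(* For a = 0 and t = bound_C the quotient is 0 / 0, which is 0 here: this is the
   limit of the expression as t decreases to bound_C. *)
Definition bound_D rho gamma a t : R :=
  let A := bound_A rho gamma in
  let B := bound_B rho gamma a in
  let C := bound_C rho gamma a in
  2 * (t - C) / (B + Num.sqrt (B ^+ 2 + 4 * A * (t - C))).

(* With 0 ^+ 0 = 1 the general formula would give e at p = 1. *)
Definition gamma_tail_const (p : nat) : R :=
  if p == 1%N then 1
  else expR 1 * (2 * p.-1%:R / expR 1) ^+ p.-1.

End constants.

(* Main.v *)
(** Write [d] for the difference of the private and the exact minimizer. Strong
    convexity at both minimizers bounds the excess loss by
    [- <b / n + gamma theta_opt, d> - (rho + 2 gamma) / 2 |d|^2], hence by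
    [(|b| / n + gamma a0)^2 / (2 (rho + 2 gamma))] and a fortiori by
    [A s^2 + B s + C] with [s = |b| / n]; [D t] is the nonnegative root of
    [A s^2 + B s + C = t]. The failure event is measurable because the private
    minimizer is Lipschitz in the noise and a finite convex function is continuous.

    The tails need no polar coordinates and no normalizing constants: both follow
    from the scaling [s ^ p] of Lebesgue measure under dilations. For the gamma noise,
    a layer-cake formula reduces
    [int_{|x| >= r} e^{- beta |x|} <= 2^(p-1) e^{- beta r / 2} int e^{- beta |x|}]
    to comparing volumes of shells and balls; the constant [2^(p-1)] is below [C_p].
    The Gaussian tail is a Chernoff bound by exponential tilting. *)

Require Import Defs.
From mathcomp Require Import all_boot all_order all_algebra.
From mathcomp Require Import all_classical all_reals all_analysis.
From mathcomp Require Import measurable_realfun.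
From mathcomp Require Import ring lra.

Set Implicit Arguments.
Unset Strict Implicit.
Unset Printing Implicit Defensive.

Import Order.TTheory GRing.Theory Num.Theory.
Import numFieldNormedType.Exports.

Local Open Scope classical_set_scope.
Local Open Scope ring_scope.

(** * Inner product, Euclidean norm and comparison with the sup norm *)

Section euclidean_geometry.
Context {R : realType} {n : nat}.
Implicit Types (x y z : 'rV[R]_n) (a t : R).

Lemma norm2_ge0 x : 0 <= norm2 x.
Proof. exact: sqrtr_ge0. Qed.

Lemma norm2_sqr x : norm2 x ^+ 2 = \sum_i x ord0 i ^+ 2.
Proof. by rewrite sqr_sqrtr// sumr_ge0// => i _; exact: sqr_ge0. Qed.

Lemma norm2_sqrE x : norm2 x ^+ 2 = dot x x.
Proof. by rewrite norm2_sqr; apply: eq_bigr => i _; rewrite expr2. Qed.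

Lemma dotC x y : dot x y = dot y x.
Proof. by apply: eq_bigr => i _; rewrite mulrC. Qed.

Lemma dotDl x y z : dot (x + y) z = dot x z + dot y z.
Proof. by rewrite -big_split; apply: eq_bigr => i _; rewrite mxE mulrDl. Qed.

Lemma dotZl a x y : dot (a *: x) y = a * dot x y.
Proof. by rewrite mulr_sumr; apply: eq_bigr => i _; rewrite mxE mulrA. Qed.

Lemma dotBl x y z : dot (x - y) z = dot x z - dot y z.
Proof. by rewrite dotDl -[- y]scaleN1r dotZl mulN1r. Qed.

Lemma dotDr x y z : dot x (y + z) = dot x y + dot x z.
Proof. by rewrite dotC dotDl !(dotC x). Qed.

Lemma dotZr a x y : dot x (a *: y) = a * dot x y.
Proof. by rewrite dotC dotZl (dotC x). Qed.

Lemma dotBr x y z : dot x (y - z) = dot x y - dot x z.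
Proof. by rewrite dotC dotBl !(dotC x). Qed.

Lemma coord_le_norm2 x i : `|x ord0 i| <= norm2 x.
Proof.
rewrite -(@ler_pXn2r _ 2)// ?nnegrE ?norm2_ge0// norm2_sqr real_normK ?num_real//.
rewrite (bigD1 i)//= lerDl sumr_ge0// => j _; exact: sqr_ge0.
Qed.

Lemma mx_norm_le_norm2 x : `|x| <= norm2 x.
Proof.
rewrite [leLHS]/Num.norm/= mx_normrE; apply/bigmax_leP; split=> [|[i j] _ /=].
  exact: norm2_ge0.
by rewrite ord1; exact: coord_le_norm2.
Qed.

Lemma norm2Z a x : 0 <= a -> norm2 (a *: x) = a * norm2 x.
Proof.
move=> a0; apply/eqP; rewrite -(@eqrXn2 _ 2)// ?mulr_ge0 ?norm2_ge0//.
by rewrite exprMn !norm2_sqrE dotZl dotZr expr2 mulrA.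
Qed.

Lemma norm2N x : norm2 (- x) = norm2 x.
Proof. by congr Num.sqrt; apply: eq_bigr => i _; rewrite mxE sqrrN. Qed.

Lemma norm20 : norm2 (0 : 'rV[R]_n) = 0.
Proof. by rewrite -(scale0r (0 : 'rV[R]_n)) norm2Z// mul0r. Qed.

(** With [a] and [b] the two norms, expanding [|b x - a y|^2 >= 0] gives
    [2 a b (a b - dot x y) >= 0]. If [a b = 0], one of the vectors has only zero coordinates. *)
Lemma cauchy_schwarz x y : dot x y <= norm2 x * norm2 y.
Proof.
have := norm2_ge0 x; have := norm2_ge0 y.
have := norm2_sqrE x; have := norm2_sqrE y.
set a := norm2 x; set b := norm2 y => bE aE b0 a0.
have [ab0|ab0] := ltP 0 (a * b).
  have : 0 <= norm2 (b *: x - a *: y) ^+ 2 by exact: sqr_ge0.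
  rewrite norm2_sqrE !(dotBl, dotBr, dotZl, dotZr) -aE -bE (dotC y x) => h.
  have : 0 <= (a * b) * (a * b - dot x y) by nra.
  by rewrite pmulr_rge0// subr_ge0.
have /eqP : a * b = 0 by apply/eqP; rewrite eq_le ab0 mulr_ge0.
have norm0 z w : norm2 z = 0 -> dot z w = 0.
  move=> z0; rewrite /dot big1// => i _; have := coord_le_norm2 z i.
  by rewrite z0 normr_le0 => /eqP ->; rewrite mul0r.
by rewrite mulf_eq0 => /orP[] /eqP h; rewrite [in leRHS]/= h ?mul0r ?mulr0
  ?(norm0 _ _ h)// dotC (norm0 _ _ h).
Qed.

Lemma norm2D x y : norm2 (x + y) <= norm2 x + norm2 y.
Proof.
rewrite -(@ler_pXn2r _ 2)// ?nnegrE ?addr_ge0 ?norm2_ge0//.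
have := cauchy_schwarz x y.
rewrite sqrrD !norm2_sqrE dotDl !dotDr (dotC y x); lra.
Qed.

(* Young's inequality: complete the square in [a *: x + y]. *)
Lemma dot_ge_norm2 x y a : 0 < a ->
  - (norm2 x ^+ 2 / (2 * a)) <= dot x y + a / 2 * norm2 y ^+ 2.
Proof.
move=> a0; have : 0 <= norm2 (a^-1 *: x + y) ^+ 2 by exact: sqr_ge0.
rewrite !norm2_sqrE !(dotDl, dotDr, dotZl, dotZr) (dotC y x) => h.
have : 0 <= a / 2 * (a^-1 * (a^-1 * dot x x) + a^-1 * dot x y
    + (a^-1 * dot x y + dot y y)).
  by apply: mulr_ge0 h; rewrite divr_ge0// ltW.
suff -> : a / 2 * (a^-1 * (a^-1 * dot x x) + a^-1 * dot x y
    + (a^-1 * dot x y + dot y y))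
  = dot x x / (2 * a) + (dot x y + a / 2 * dot y y) by lra.
field; lra.
Qed.

Lemma norm2_convex_comb t x y : norm2 (t *: x + (1 - t) *: y) ^+ 2 =
  t * norm2 x ^+ 2 + (1 - t) * norm2 y ^+ 2 - t * (1 - t) * norm2 (x - y) ^+ 2.
Proof.
rewrite !norm2_sqrE !(dotBl, dotBr, dotDl, dotDr, dotZl, dotZr) (dotC y x).
ring.
Qed.

Lemma continuous_norm2 : continuous (@norm2 R n).
Proof.
move=> x; apply: continuous_comp; last exact: sqrt_continuous.
apply: continuous_big => [z|i _ y]; first exact: add_continuous.
apply: (@continuous_comp _ _ _ (fun v : 'rV[R]_n => v ord0 i) (fun r => r ^+ 2)).
  exact: coord_continuous.
exact: exprn_continuous.
Qed.

End euclidean_geometry.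

(** * Strong convexity, growth at a minimizer, and continuity of convex functions *)

Section convex_functions.
Context {R : realType} {n : nat}.
Implicit Types (f : 'rV[R]_n -> R) (A : set 'rV[R]_n) (x y : 'rV[R]_n).

Lemma convex_setP A x y (t : R) : convex_set A -> A x -> A y -> 0 <= t <= 1 ->
  A (t *: x + (1 - t) *: y).
Proof.
move=> cA Ax Ay /andP[t0 t1].
exact: set_mem (cA x y (Itv01 t0 t1) (mem_set Ax) (mem_set Ay)).
Qed.

Lemma strongly_convexD rho rho' f g : strongly_convex rho f ->
  strongly_convex rho' g -> strongly_convex (rho + rho') (f \+ g).
Proof.
move=> cf cg t x y t01; have := cf t x y t01; have := cg t x y t01 => /=.
lra.
Qed.

Lemma strongly_convex_sqr (g : R) :
  strongly_convex g (fun x => g / 2 * norm2 x ^+ 2).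
Proof. by move=> t x y _; rewrite norm2_convex_comb; lra. Qed.

Lemma strongly_convex_dot (b : 'rV[R]_n) (c : R) :
  strongly_convex 0 (fun x => dot b x / c).
Proof. by move=> t x y _; rewrite dotDr !dotZr; lra. Qed.

Lemma strongly_convexW rho f : 0 <= rho -> strongly_convex rho f ->
  strongly_convex 0 f.
Proof.
move=> rho0 cf t x y t01; apply: (le_trans (cf t x y t01)).
rewrite !mul0r subr0 lerBlDr lerDl.
move: t01 => /andP[t0 t1].
by apply/mulr_ge0/sqr_ge0; rewrite mulr_ge0 ?divr_ge0// mulr_ge0 ?subr_ge0.
Qed.

(** Compare [x] with [t y + (1 - t) x], which stays in [A], and divide by [t]: this gives
    [f x + c (1 - t) <= f y] for [0 < t < 1], and a small [t] concludes. *)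
Lemma strongly_convex_argmin rho f A x y : strongly_convex rho f ->
  convex_set A -> argmin A f x -> A y ->
  f x + rho / 2 * norm2 (y - x) ^+ 2 <= f y.
Proof.
move=> cf cA [Ax fx] Ay; set c := rho / 2 * _.
have key t : 0 < t -> t < 1 -> f x + c * (1 - t) <= f y.
  move=> t0 t1; have t01 : 0 <= t <= 1 by rewrite !ltW.
  have := fx _ (convex_setP cA Ay Ax t01); have := cf t y x t01.
  rewrite -/c => h1 h2; have : t * (f x + c * (1 - t)) <= t * f y.
    by move: (le_trans h2 h1); rewrite /c; lra.
  by rewrite ler_pM2l.
rewrite leNgt; apply/negP => lt_fy.
have : 0 < c by have := fx _ Ay; lra.
(* With this [t], [t c] is half of the supposed gap [f x + c - f y > 0], so [key] would bound the
   gap by half of itself. *)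
move=> c0; pose t := (f x + c - f y) / (2 * c).
have tc : t * c = (f x + c - f y) / 2 by rewrite /t; field; lra.
have t0 : 0 < t by rewrite divr_gt0//; lra.
have t1 : t < 1 by rewrite ltr_pdivrMr; have := fx _ Ay; lra.
have := key t t0 t1; rewrite mulrBr mulr1 (mulrC c); lra.
Qed.

(* Around a point, a convex function grows at most linearly along each
   coordinate axis, and [g (y + z) <= (g (2 y) + g (2 z)) / 2] combines the axes. *)
Lemma convex_linear_bound f : strongly_convex 0 f ->
  forall x, exists2 M : R, 0 <= M & exists2 d : R, 0 < d &
    forall h, `|h| <= d -> f (x + h) - f x <= M * `|h|.
Proof.
move=> cf x; pose g h := f (x + h) - f x.
have cg t y z : 0 <= t <= 1 ->
    g (t *: y + (1 - t) *: z) <= t * g y + (1 - t) * g z.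
  move=> t01; have := cf t (x + y) (x + z) t01; rewrite !mul0r subr0.
  have -> : t *: (x + y) + (1 - t) *: (x + z) = x + (t *: y + (1 - t) *: z).
    by rewrite !scalerDr addrACA -scalerDl subrKC scale1r.
  by rewrite /g; lra.
have g0 : g 0 = 0 by rewrite /g addr0 subrr.
have half y z : g (y + z) <= 2^-1 * g (2 *: y) + 2^-1 * g (2 *: z).
  have := cg 2^-1 (2 *: y) (2 *: z); rewrite !scalerA mulVf ?pnatr_eq0//.
  have -> : 1 - 2^-1 = 2^-1 :> R by lra.
  by rewrite mulVf ?pnatr_eq0// !scale1r; apply; lra.
(* According to the sign of [c], [c e] lies on the segment from 0, where [g] vanishes, to [e] or to
   [- e]; convexity on that segment gives linear growth. *)
have axis (e : 'rV[R]_n) (c : R) : `|c| <= 1 ->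
    g (c *: e) <= (`|g e| + `|g (- e)|) * `|c|.
  have pos (e' : 'rV[R]_n) (c' : R) : 0 <= c' <= 1 -> g (c' *: e') <= `|g e'| * c'.
    move=> c01; have := cg c' e' 0 c01; rewrite scaler0 addr0 g0 mulr0 addr0.
    move=> /le_trans; apply; rewrite mulrC ler_wpM2r ?ler_norm//.
    by case/andP: c01.
  have [c0|c0] := leP 0 c => c1.
    rewrite (ger0_norm c0) in c1 *.
    by have := pos e c; rewrite c0 c1 => /(_ isT) /le_trans; apply;
      rewrite ler_wpM2r// lerDl.
  rewrite (ltr0_norm c0) in c1 *.
  have := pos (- e) (- c); rewrite oppr_ge0 (ltW c0) c1 scaleNr scalerN opprK.
  by move=> /(_ isT) /le_trans; apply; rewrite ler_wpM2r ?oppr_ge0 ?(ltW c0)// lerDr.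
suff [M M0 [d d0 H]] : exists2 M : R, 0 <= M & exists2 d : R, 0 < d &
    forall h : 'rV[R]_n, `|h| <= d -> g (\sum_(i <- enum 'I_n) h ord0 i *: 'e_i) <= M * `|h|.
  exists M => //; exists d => // h hd.
  by rewrite -/(g h) {1}(row_sum_delta h) -big_enum; exact: H.
elim: (enum _) => [|i s [M M0 [d d0 H]]].
  by exists 0 => //; exists 1 => // h _; rewrite big_nil g0 mul0r.
pose N := `|g 'e_i| + `|g (- 'e_i)|.
exists (N + M); first by rewrite !addr_ge0.
(* Since [half] evaluates at doubled vectors, halving the radius keeps [2 h] within [d] for the
   induction hypothesis and within 1 for [axis]. *)
exists (Num.min d 1 / 2) => [|h hd].
  by rewrite divr_gt0// lt_min d0 ltr01.
have hd2 : `|2 *: h| <= d /\ `|2 *: h| <= 1.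
  rewrite normrZ ger0_norm//; move: hd; rewrite ler_pdivlMr// le_min mulrC.
  by move=> /andP[].
have hi : `|(2 *: h) ord0 i| <= `|2 *: h|.
  rewrite [leRHS]/Num.norm/= mx_normrE; apply/bigmax_geP; right.
  by exists (ord0, i).
rewrite big_cons; apply: (le_trans (half _ _)).
have -> : 2 *: (\sum_(j <- s) h ord0 j *: 'e_j) =
    \sum_(j <- s) (2 *: h) ord0 j *: 'e_j :> 'rV[R]_n.
  by rewrite scaler_sumr; apply: eq_bigr => j _; rewrite scalerA mxE.
have -> : 2 *: (h ord0 i *: 'e_i) = (2 *: h) ord0 i *: 'e_i :> 'rV[R]_n.
  by rewrite scalerA mxE.
have := H _ hd2.1; have := axis 'e_i _ (le_trans hi hd2.2); rewrite -/N => h1 h2.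
have h3 : N * `|(2 *: h) ord0 i| <= N * `|2 *: h|.
  by rewrite ler_wpM2l ?addr_ge0.
have : `|2 *: h| = 2 * `|h| by rewrite normrZ ger0_norm.
move=> h4; rewrite h4 in h1 h2 h3 *; lra.
Qed.

(** As [x] is the midpoint of [x + h] and [x - h], the linear upper bound at [- h] turns into a
    lower bound at [h]. *)
Lemma convex_continuous f : strongly_convex 0 f -> continuous f.
Proof.
move=> cf x; have [M M0 [d d0 Md]] := convex_linear_bound cf x.
have two h : `|h| <= d -> `|f (x + h) - f x| <= M * `|h|.
  move=> hd; rewrite ler_norml (Md _ hd) andbT.
  have := Md (- h); rewrite normrN => /(_ hd).
  have := cf 2^-1 (x + h) (x - h).
  have -> : 2^-1 *: (x + h) + (1 - 2^-1) *: (x - h) = x.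
    have -> : 1 - 2^-1 = 2^-1 :> R by lra.
    rewrite -scalerDr addrACA subrr addr0 -[x + x]mulr2n -[x *+ 2]scaler_nat scalerA.
    by rewrite mulVf ?pnatr_eq0// scale1r.
  have h01 : 0 <= (2^-1 : R) <= 1 by lra.
  by move=> /(_ h01); rewrite !mul0r subr0; lra.
apply/(@cvgrPdist_le _ _ _ (nbhs x) (nbhs_filter x)) => e e0; apply/nbhs_ballP.
(* [M] may be 0, hence the division by [M + 1]. *)
exists (Num.min d (e / (M + 1))) => [|y].
  by rewrite /= lt_min d0 divr_gt0// ltr_wpDl.
rewrite -ball_normE /ball_/= lt_min => /andP[/ltW yd /ltW yM].
rewrite distrC in yd yM; rewrite distrC -(subrKC x y) (le_trans (two _ yd))//.
rewrite (le_trans (ler_wpM2l M0 yM))// mulrCA ger_pMr//.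
by rewrite ler_pdivrMr ?ltr_wpDl// mul1r lerDl.
Qed.

End convex_functions.

(** * Signs of the constants in the bound *)

Lemma bound_A_ge0 {R : realType} (rho gamma : R) : 0 <= rho -> 0 <= gamma ->
  0 <= bound_A rho gamma.
Proof.
move=> rho0 gamma0; apply: divr_ge0;
  by do ?[by []|exact: sqr_ge0|apply: addr_ge0|apply: mulr_ge0].
Qed.

Lemma bound_B_ge0 {R : realType} (rho gamma a : R) : 0 <= rho -> 0 <= gamma ->
  0 <= a -> 0 <= bound_B rho gamma a.
Proof.
move=> rho0 gamma0 a0; apply: divr_ge0;
  by do ?[by []|exact: sqr_ge0|apply: addr_ge0|apply: mulr_ge0].
Qed.

Lemma bound_D_ge0 {R : realType} (rho gamma a t : R) : 0 <= rho -> 0 <= gamma ->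
  0 <= a -> bound_C rho gamma a <= t -> 0 <= bound_D rho gamma a t.
Proof.
move=> rho0 gamma0 a0 Ct; apply: divr_ge0; first by rewrite mulr_ge0// subr_ge0.
by rewrite addr_ge0 ?sqrtr_ge0// bound_B_ge0.
Qed.

(** * The private minimizer: existence, stability in the noise, excess loss *)

Section perturbed_minimizer.
Context {R : realType} {n p : nat}.
Implicit Types (b theta : 'rV[R]_p).
Variables (Theta : set 'rV[R]_p) (L : 'rV[R]_p -> R) (rho gamma : R).
Variable theta_opt : 'rV[R]_p.
Hypotheses (n_gt0 : (0 < n)%N) (rho_ge0 : 0 <= rho) (gamma_gt0 : 0 < gamma).
Hypotheses (Theta_closed : closed Theta) (Theta_convex : convex_set Theta).
Hypothesis L_convex : strongly_convex rho L.
Hypothesis theta_opt_min : argmin Theta L theta_opt.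

Lemma strongly_convex_perturbed b :
  strongly_convex (rho + gamma) (perturbed_objective n L gamma b).
Proof.
rewrite -[rho + gamma]addr0; apply: strongly_convexD (strongly_convex_dot b _).
exact: strongly_convexD (strongly_convex_sqr gamma).
Qed.

(** The points of [Theta] that do no worse than [theta_opt] form a compact set: on [Theta] the loss
    [L] is bounded below by [L theta_opt], so the quadratic term dominates the linear one. *)
Lemma perturbed_argmin_nonempty b :
  argmin Theta (perturbed_objective n L gamma b) !=set0.
Proof.
pose H := perturbed_objective n L gamma b.
have Hc : continuous H.
  apply: convex_continuous; apply: strongly_convexW (strongly_convex_perturbed b).
  by rewrite addr_ge0// ltW.
have [Topt Lopt] := theta_opt_min.
pose S := Theta `&` [set x | H x <= H theta_opt].
have S0 : S theta_opt by split => /=.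
have cS : closed S.
  apply: closedI => //.
  exact: (closed_comp (fun x _ => Hc x) (@closed_le _ (H theta_opt))).
have bS : bounded_set S.
  pose c := norm2 b / n%:R.
  (* A norm [z] beyond this radius has [gamma z / 2 > c + |e|] and [z > 1], hence
     [gamma / 2 z^2 - c z > |e|], against [Hx']. *)
  exists (1 + `|2 / gamma| * (c + `|H theta_opt - L theta_opt|)).
  split; first exact: num_real.
  move=> M ltM x [Tx Hx]; apply: (le_trans (mx_norm_le_norm2 x)).
  rewrite leNgt; apply/negP => Mx; have := lt_trans ltM Mx.
  set z := norm2 x; set e := H theta_opt - L theta_opt => zlt.
  have Hx' : gamma / 2 * z ^+ 2 - c * z <= e.
    have cs : - (c * z) <= dot b x / n%:R.
      rewrite /c mulrAC -mulNr ler_wpM2r ?invr_ge0// lerNl.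
      have := cauchy_schwarz (- 1 *: b) x.
      rewrite dotZl mulN1r => /le_trans; apply.
      by rewrite scaleN1r norm2N.
    have := Lopt _ Tx; move: Hx; rewrite /= {1}/H /perturbed_objective -/z /e.
    lra.
  have c0 : 0 <= c by rewrite divr_ge0// norm2_ge0.
  have z1 : 1 < z.
    by apply: le_lt_trans zlt; rewrite lerDl mulr_ge0// addr_ge0.
  have : 2 / gamma * (c + `|e|) < z.
    apply: le_lt_trans zlt; rewrite [`|2 / gamma|]ger0_norm ?divr_ge0 ?(ltW gamma_gt0)//.
    by rewrite lerDr ler01.
  rewrite mulrAC ltr_pdivrMr// => h.
  have eN := ler_norm e; have e0 := normr_ge0 e.
  have : 0 < (z * gamma - 2 * (c + `|e|)) * z by rewrite mulr_gt0 ?subr_gt0//; lra.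
  have : 0 <= `|e| * (z - 1) by rewrite mulr_ge0// subr_ge0 ltW.
  lra.
have [x /set_mem[Tx Hx] xmin] := EVT_min_rV (ex_intro _ theta_opt S0)
  (bounded_closed_compact bS cS) (continuous_subspaceT Hc).
exists x; split => // y Ty.
have [yS|/ltW] := leP (H y) (H theta_opt); first by apply/xmin/mem_set.
exact: le_trans.
Qed.

(** Existence rules out the default value 0 of [xget]. *)
Lemma private_minimizer_argmin b : argmin Theta
  (perturbed_objective n L gamma b) (private_minimizer n Theta L gamma b).
Proof. exact: (xgetPex 0 (perturbed_argmin_nonempty b)). Qed.

(** Test each perturbed objective at the minimizer of the other and add: all but the noise terms
    cancel, leaving [(rho + gamma) d^2 <= dot (b' - b) (x - y) / n]. Cauchy-Schwarz and division by
    [d] conclude. *)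
Lemma private_minimizer_lipschitz b b' :
  norm2 (private_minimizer n Theta L gamma b -
         private_minimizer n Theta L gamma b') <=
  (gamma * n%:R)^-1 * norm2 (b - b').
Proof.
set x := private_minimizer _ _ _ _ b; set y := private_minimizer _ _ _ _ b'.
have [Tx _] := private_minimizer_argmin b.
have [Ty _] := private_minimizer_argmin b'.
have := strongly_convex_argmin (strongly_convex_perturbed b) Theta_convex
  (private_minimizer_argmin b) Ty.
have := strongly_convex_argmin (strongly_convex_perturbed b') Theta_convex
  (private_minimizer_argmin b') Tx.
rewrite -/x -/y /perturbed_objective.
have -> : norm2 (y - x) ^+ 2 = norm2 (x - y) ^+ 2.
  by rewrite -opprB norm2N.
set d := norm2 (x - y) => h1 h2.
have n0 : 0 < n%:R :> R by rewrite ltr0n.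
have h3 : (rho + gamma) * d ^+ 2 <= dot (b' - b) (x - y) / n%:R.
  by rewrite dotBl !dotBr; lra.
have h4 : gamma * d ^+ 2 <= norm2 (b' - b) * d / n%:R.
  apply: (@le_trans _ _ ((rho + gamma) * d ^+ 2)).
    by rewrite ler_wpM2r ?sqr_ge0// lerDr.
  by apply: (le_trans h3); rewrite ler_wpM2r ?invr_ge0 ?cauchy_schwarz.
have d0 : 0 <= d by exact: norm2_ge0.
rewrite -[b - b']opprB norm2N mulrC ler_pdivlMr ?mulr_gt0//.
have [->|dn0] := eqVneq d 0; first by rewrite mul0r norm2_ge0.
have dgt : 0 < d by rewrite lt_neqAle eq_sym dn0.
rewrite -(ler_pM2r dgt); move: h4; rewrite ler_pdivlMr//; lra.
Qed.

Lemma private_minimizer_continuous :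
  continuous (private_minimizer n Theta L gamma).
Proof.
move=> b; apply/(@cvgrPdist_le _ _ _ (nbhs b) (nbhs_filter b)) => e e0.
set c := (gamma * n%:R)^-1.
have c0 : 0 < c by rewrite invr_gt0 mulr_gt0// ltr0n.
have : nbhs b [set b' | `|norm2 (0 : 'rV[R]_p) - norm2 (b - b')| < e / c].
  have cont : {for b, continuous (fun b' : 'rV[R]_p => norm2 (b - b'))}.
    apply: (@continuous_comp _ _ _ (fun b' => b - b')); last exact: continuous_norm2.
    by apply: continuousB; [exact: cst_continuous|move=> ? ?; exact].
  move/(@cvgrPdist_lt _ _ _ (nbhs b) (nbhs_filter b)) : cont.
  by rewrite subrr; apply; rewrite divr_gt0.
apply: filterS => b' /=.
rewrite distrC norm20 subr0 ger0_norm ?norm2_ge0// ltr_pdivlMr// => /ltW be.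
apply: (le_trans (mx_norm_le_norm2 _)).
by apply: (le_trans (private_minimizer_lipschitz b b')); rewrite mulrC.
Qed.

(* Adding the optimality of [theta_opt] for [L] to that of the private minimizer
   leaves a concave quadratic in their difference. *)
Lemma private_excess_loss b (a := norm2 theta_opt) (s := norm2 b / n%:R) :
  L (private_minimizer n Theta L gamma b) - L theta_opt <=
  bound_A rho gamma * s ^+ 2 + bound_B rho gamma a * s + bound_C rho gamma a.
Proof.
set x := private_minimizer _ _ _ _ b.
have [Tx _] := private_minimizer_argmin b.
have [To _] := theta_opt_min.
(* Growth of the perturbed objective at the private minimizer, tested at [theta_opt]. In terms of
   [d], it bounds the excess loss by [- dot u d - (rho + 2 gamma) / 2 |d|^2], to which
   [dot_ge_norm2] applies. *)
have := strongly_convex_argmin (strongly_convex_perturbed b) Theta_convex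
  (private_minimizer_argmin b) To.
rewrite -/x /perturbed_objective => h.
have n0 : 0 < n%:R :> R by rewrite ltr0n.
pose u := n%:R^-1 *: b + gamma *: theta_opt.
have [d xE] : exists d, x = theta_opt + d by exists (x - theta_opt); rewrite subrKC.
have nd : norm2 (theta_opt - x) = norm2 d.
  by rewrite xE opprD addrA subrr add0r norm2N.
have nx : norm2 x ^+ 2 = a ^+ 2 + 2 * dot theta_opt d + norm2 d ^+ 2.
  by rewrite xE !norm2_sqrE !(dotDl, dotDr) (dotC d); lra.
have bx : dot b x = dot b theta_opt + dot b d by rewrite xE dotDr.
have k0 : 0 < rho + 2 * gamma by move: rho_ge0 gamma_gt0; lra.
have := dot_ge_norm2 u d k0.
rewrite dotDl !dotZl => young.
have hL : L x - L theta_opt <= norm2 u ^+ 2 / (2 * (rho + 2 * gamma)).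
  move: h; rewrite nd nx bx -/a => h; lra.
have s0 : 0 <= s by rewrite divr_ge0// norm2_ge0.
have a0 : 0 <= a by exact: norm2_ge0.
have nu : norm2 u ^+ 2 <= (s + gamma * a) ^+ 2.
  rewrite ler_sqr ?nnegrE ?norm2_ge0 ?addr_ge0 ?mulr_ge0 ?norm2_ge0 ?(ltW gamma_gt0)//.
  by rewrite (le_trans (norm2D _ _))//
    !norm2Z ?invr_ge0 ?(ltW gamma_gt0)// [_ * norm2 b]mulrC.
apply: (le_trans hL).
apply: (@le_trans _ _ ((s + gamma * a) ^+ 2 / (2 * (rho + 2 * gamma)))).
  by rewrite ler_wpM2r// invr_ge0; lra.
have k1 : 0 < rho + gamma by move: rho_ge0 gamma_gt0; lra.
rewrite /bound_A /bound_B /bound_C -subr_ge0.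
(* Over the common denominator the numerator is a polynomial in [rho], [gamma], [a], [s] with
   nonnegative coefficients. *)
have -> : (2 * rho + 3 * gamma) / (2 * (rho + gamma) ^+ 2) * s ^+ 2 +
  a * gamma * (rho + 3 * gamma) / (rho + gamma) ^+ 2 * s +
  2 * a ^+ 2 * (rho + 2 * gamma) / (rho + gamma) ^+ 2 * gamma ^+ 2 -
  (s + gamma * a) ^+ 2 / (2 * (rho + 2 * gamma)) =
  ((rho ^+ 2 + 5 * rho * gamma + 5 * gamma ^+ 2) * s ^+ 2 +
   2 * (a * gamma * s) * (3 * rho * gamma + 5 * gamma ^+ 2) +
   (a * gamma) ^+ 2 * (3 * rho ^+ 2 + 14 * rho * gamma + 15 * gamma ^+ 2)) /
  (2 * (rho + 2 * gamma) * (rho + gamma) ^+ 2).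
  field; lra.
have g0 := ltW gamma_gt0.
by apply: divr_ge0; do ?[by []|exact: sqr_ge0|apply: addr_ge0|apply: mulr_ge0].
Qed.

(** By contraposition: if [s < D], then [s q < 2 (t - C) - B s], and squaring gives
    [A s^2 + B s + C < t], against the excess loss bound. *)
Lemma failure_noise_ge b t (a := norm2 theta_opt) : bound_C rho gamma a <= t ->
  L theta_opt + t <= L (private_minimizer n Theta L gamma b) ->
  n%:R * bound_D rho gamma a t <= norm2 b.
Proof.
move=> Ct Lt; have := private_excess_loss b.
rewrite /= -/a /bound_D; set A := bound_A _ _; set B := bound_B _ _ _.
set C := bound_C _ _ _ in Ct *; set s := norm2 b / n%:R => h.
have n0 : 0 < n%:R :> R by rewrite ltr0n.
rewrite mulrC -ler_pdivlMr// -/s.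
have s0 : 0 <= s by rewrite divr_ge0// norm2_ge0.
have A0 : 0 <= A by exact/bound_A_ge0/ltW.
have B0 : 0 <= B by apply: bound_B_ge0 => //; [exact: ltW|exact: norm2_ge0].
set q := Num.sqrt _.
have q0 : 0 <= q by exact: sqrtr_ge0.
have qE : q ^+ 2 = B ^+ 2 + 4 * A * (t - C).
  by rewrite sqr_sqrtr// addr_ge0 ?sqr_ge0// mulr_ge0 ?subr_ge0// mulr_ge0.
have [Bq|Bq] := ltP 0 (B + q); last first.
  (* Here the quotient defining [D] has denominator 0, so its value is 0 and the claim is
     [0 <= s]. *)
  have -> : B + q = 0 by apply/eqP; rewrite eq_le Bq addr_ge0.
  by rewrite invr0 mulr0.
rewrite ler_pdivrMr// leNgt; apply/negP => lt_s.
have x0 : 0 < t - C by have := mulr_ge0 s0 (ltW Bq); lra.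
have : (s * q) ^+ 2 < (2 * (t - C) - B * s) ^+ 2.
  have sq0 : 0 <= s * q by exact: mulr_ge0.
  by rewrite ltr_pXn2r ?nnegrE//; lra.
rewrite exprMn qE => lt_sqr.
have : (t - C) * (A * s ^+ 2 + B * s) < (t - C) * (t - C) by lra.
by rewrite ltr_pM2l//; lra.
Qed.

End perturbed_minimizer.

(** * Measurability of open sets and of continuous functions *)

Section borel_rV.
Context {R : realType} {n : nat}.

Lemma measurable_box (A : 'I_n -> set R) : (forall i, measurable (A i)) ->
  measurable [set x : 'rV[R]_n | forall i, A i (x ord0 i)].
Proof.
move=> mA; rewrite (_ : [set x | _] = \bigcap_(i in [set: 'I_n])
    ((fun x : 'rV[R]_n => x ord0 i) @^-1` A i)).
  apply: fin_bigcap_measurable => // i _.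
  by rewrite -[X in measurable X]setTI; exact: measurable_coord.
by apply/seteqP; split=> [x Ax i _|x Ax i]; exact: Ax.
Qed.

(* An open set is the union of the boxes with rational centre and inverse integer
   half-width that it contains. *)
Lemma open_measurable_rV (U : set 'rV[R]_n) : open U -> measurable U.
Proof.
move=> oU.
pose box (q : {ffun 'I_n -> rat} * nat) : set 'rV[R]_n :=
  [set x | forall i, ball (ratr (q.1 i) : R) q.2.+1%:R^-1 (x ord0 i)].
(* The second set is everything or empty, so a box is kept exactly when it lies in [U], and the
   union runs over one countable type. *)
rewrite (_ : U = \bigcup_q (box q `&` [set _ | box q `<=` U])).
  apply: countable_bigcupT_measurable => [|q]; first exact: countableP.
  have [qU|qU] := pselect (box q `<=` U).
    rewrite (_ : [set _ | _] = setT) ?setIT; last by apply/seteqP; split.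
    apply: (measurable_box (A := fun i => ball (ratr (q.1 i) : R) q.2.+1%:R^-1)) => i.
    exact: measurable_ball.
  by rewrite (_ : [set _ | _] = set0) ?setI0//; apply/seteqP; split.
apply/seteqP; split => [x Ux|x [q _] [qx qU]]; last exact: qU.
have /nbhs_ballP[e e0 eU] := open_nbhs_nbhs (conj oU Ux).
have [k ke] : exists k, k.+1%:R^-1 < e / 2.
  have e20 : 0 < e / 2 by exact: divr_gt0.
  have [k _ /(_ k (leqnn k)) ke] := near_infty_natSinv_lt (PosNum e20).
  by exists k.
have /choice[q qx] : forall i, exists q : rat,
    `|ratr q - x ord0 i| < k.+1%:R^-1.
  move=> i; have [|q] := @rat_in_itvoo R (x ord0 i - k.+1%:R^-1) (x ord0 i + k.+1%:R^-1).
    by rewrite ltrD2l gtrN.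
  by rewrite in_itv/= => qi; exists q; rewrite ltr_distl.
exists ([ffun i => q i], k) => //.
have xbox : box ([ffun i => q i], k) x.
  by move=> i /=; rewrite ffunE -ball_normE; exact: qx.
split => // y ybox; apply: eU.
rewrite -ball_normE /ball_/=.
rewrite [X in X < _]/Num.norm/= mx_normrE; apply/bigmax_ltP; split=> // -[i j] _ /=.
rewrite ord1 !mxE.
have := ybox j; rewrite -ball_normE/= ffunE /ball_/= => yj.
rewrite -(subrKA (ratr (q j))) (le_lt_trans (ler_normD _ _))// (splitr e).
rewrite ltrD//; last exact: lt_trans yj ke.
by rewrite distrC; exact: lt_trans (qx j) ke.
Qed.

Lemma continuous_measurable_rV (f : 'rV[R]_n -> R) :
  continuous f -> measurable_fun setT f.
Proof.
move=> cf; apply: (measurability _ (RGenOpens.measurableE R)).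
move=> /= _ [_ [a [b' ->]] <-]; apply: measurableI => //; apply: open_measurable_rV.
by apply: open_comp => [x _|]; [exact: cf|exact: interval_open].
Qed.

Lemma measurable_norm2 : measurable_fun setT (@norm2 R n).
Proof.
by apply: continuous_measurable_rV; exact: continuous_norm2.
Qed.

End borel_rV.

(** * Lebesgue measure under dilations *)

Section dilation.
Context {R : realType}.
Local Open Scope ereal_scope.

(** The pushforward by the dilation, rescaled by [s^-1], gives every half-open interval its length,
    so it is Lebesgue measure by uniqueness. *)
Lemma lebesgue_measure_dilate (s : R) (A : set R) : (0 < s)%R -> measurable A ->
  @lebesgue_measure R ((fun x => s^-1 * x)%R @^-1` A) = s%:E * lebesgue_measure A.
Proof.
move=> s0 mA; have sV0 : (0 <= s^-1)%R by rewrite invr_ge0 ltW.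
have mf : measurable_fun [set: R] (fun x : R => s^-1 * x)%R.
  exact: measurable_funM.
pose nu := mscale (NngNum sV0) (pushforward (@lebesgue_measure R)
  (fun x : R => (s^-1 * x)%R : measurableTypeR R)).
rewrite [in RHS](@lebesgue_measure_unique R (nu mf))//.
  rewrite /nu /= /mscale /= /pushforward muleA -EFinM divff ?mul1e//.
  by rewrite gt_eqF.
move=> _ [[a b]] _ <-.
rewrite /nu /= /mscale /= /pushforward.
rewrite (_ : _ @^-1` _ = `](s * a)%R, (s * b)%R]%classic); last first.
  apply/seteqP; split=> x /=; rewrite !in_itv/=
    [(s^-1 * x)%R]mulrC ltr_pdivlMr// ler_pdivrMr//;
    by rewrite [(a * s)%R]mulrC [(b * s)%R]mulrC.
rewrite !lebesgue_measure_itv/= !lte_fin ltr_pM2l//.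
case: ifPn => _; last by rewrite mule0.
by rewrite -!EFinB -EFinM -mulrBr mulKf// gt_eqF.
Qed.

Lemma measurable_scale_rV p (s : R) :
  measurable_fun setT (fun v : 'rV[R]_p => s *: v)%R.
Proof.
apply: measurable_fun_rV => i; under eq_fun do rewrite mxE.
by apply: measurable_funM => //; exact: measurable_coord.
Qed.

(** Induction on the dimension: dilations commute with [rV_cons], and the rescaled pushforward of
    the product measure agrees with it on rectangles, hence everywhere. *)
Lemma lebesgue_rV_dilate p (s : R) (A : set 'rV[R]_p) : (0 < s)%R ->
  measurable A ->
  lebesgue_rV p ((fun v => s^-1 *: v)%R @^-1` A) = (s ^+ p)%:E * lebesgue_rV p A.
Proof.
move=> s0; elim: p A => [|p IH] A mA.
  rewrite expr0 mul1e /=; congr (\d_ _ _).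
  have E v : (s^-1 *: v = v :> 'rV[R]_0)%R by rewrite [LHS]thinmx0 [RHS]thinmx0.
  by apply/seteqP; split=> v /=; rewrite E.
have sV0 : (0 <= s^-1 ^+ p.+1)%R by rewrite exprn_ge0// invr_ge0 ltW.
pose dil := fun z : measurableTypeR R * 'rV[R]_p =>
  ((s^-1 * z.1)%R : measurableTypeR R, (s^-1 *: z.2)%R).
have mdil : measurable_fun setT dil.
  apply: measurable_fun_pair; first by apply: measurable_funM => //; exact: measurable_fst.
  exact: (measurableT_comp (@measurable_scale_rV _ _)).
pose N := product_measure1 (@lebesgue_measure R) (lebesgue_rV p).
pose nu := mscale (NngNum sV0) (pushforward N dil).
have mcA : measurable (@rV_cons R p @^-1` A).
  by rewrite -[X in measurable X]setTI; exact: measurable_rV_cons.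
transitivity (N (dil @^-1` (@rV_cons R p @^-1` A))).
  congr product_measure1; apply/seteqP.
  have E z : (s^-1 *: rV_cons z = rV_cons (dil z))%R.
    apply/rowP => i; rewrite mxE; case: (unliftP ord0 i) => [j|] ->.
      by rewrite !rV_consES mxE.
    by rewrite !rV_consE0.
  by split=> z /=; rewrite E.
rewrite [lebesgue_rV p.+1 A](_ : _ = N (@rV_cons R p @^-1` A))//.
rewrite [in RHS]/N (@product_measure_unique _ _ _ _ _ _ _ (nu mdil))//.
  rewrite /nu /= /mscale /= /pushforward muleA -EFinM -exprMn.
  by rewrite divff ?expr1n ?mul1e// gt_eqF.
move=> X Y mX mY; rewrite /nu /= /mscale /= /pushforward.
transitivity ((s^-1 ^+ p.+1)%:E * N (((fun x => s^-1 * x)%R @^-1` X) `*`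
  ((fun v => s^-1 *: v)%R @^-1` Y))); first by [].
rewrite /N [X in _ * X]product_measure1E//; last 2 first.
- by rewrite -[X in measurable X]setTI; exact: measurable_funM.
- by rewrite -[X in measurable X]setTI; exact: measurable_scale_rV.
rewrite [X in _ * (X * _)](lebesgue_measure_dilate s0 mX).
rewrite [X in _ * (_ * X)](IH _ mY) muleACA -EFinM -exprS [LHS]muleA -EFinM -exprMn.
by rewrite mulVf ?gt_eqF// expr1n mul1e.
Qed.

Lemma ge0_integral_dilate p (s : R) (f : 'rV[R]_p -> \bar R) : (0 < s)%R ->
  measurable_fun setT f -> (forall x, 0 <= f x) ->
  \int[lebesgue_rV p]_x f (s^-1 *: x)%R =
  (s ^+ p)%:E * \int[lebesgue_rV p]_x f x.
Proof.
move=> s0 mf f0; have sp0 : (0 <= s ^+ p)%R by rewrite exprn_ge0// ltW.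
have mg := @measurable_scale_rV p s^-1%R.
rewrite -(ge0_integral_mscale _ _ (NngNum sp0))//.
rewrite [LHS](_ : _ = \int[lebesgue_rV p]_(x in (fun v => s^-1 *: v)%R @^-1` setT)
  (f \o (fun v => s^-1 *: v)%R) x)//.
rewrite -(ge0_integral_pushforward mg)//.
apply: eq_measure_integral => A mA _.
exact: lebesgue_rV_dilate.
Qed.

End dilation.

(** * Layer-cake comparison of exponential integrals *)

Section exponential_layer_cake.
Context {R : realType}.
Local Open Scope ereal_scope.
Local Notation leb := (@lebesgue_measure R).

Lemma integral_expR_tail (beta a : R) : (0 < beta)%R ->
  \int[leb]_(s in `[a, +oo[) (beta * expR (- (beta * s)))%:E =
  (expR (- (beta * a)))%:E.
Proof.
move=> beta0.
have dF (x : R) : is_derive x 1%R (fun s : R => - expR (- (beta * s)))%R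
    (beta * expR (- (beta * x)))%R.
  apply: is_derive_eq; rewrite mulrN opprK mulrC.
  by congr (_ * _)%R; exact: mulr1.
have cF : continuous (fun s : R => - expR (- (beta * s)))%R.
  by move=> x; apply: differentiable_continuous; apply/derivable1_diffP; case: (dF x).
have cf : continuous (fun s : R => beta * expR (- (beta * s)))%R.
  move=> x; apply: cvgM; first exact: cvg_cst.
  rewrite -[X in X @ _](_ : (fun s => - (- expR (- (beta * s)))) = _)%R.
    by rewrite -[X in _ --> X]opprK; apply: cvgN; exact: cF.
  by apply/funext => s; rewrite opprK.
rewrite (@ge0_continuous_FTC2y _ _ (fun s => - expR (- (beta * s)))%R _ 0)//.
- by rewrite EFinN oppeK add0e.
- by move=> x _; rewrite mulr_ge0 ?expR_ge0// ltW.
- exact: continuous_subspaceT.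
- rewrite -oppr0; apply: cvgN.
  apply: (@cvg_comp _ _ _ (fun s => beta * s)%R (fun z => expR (- z))%R _
    (pinfty_nbhs R)); last exact: cvgr_expR.
  exact: gt0_cvgMry.
- by apply: cvg_at_right_filter; exact: cF.
- by move=> x _; rewrite derive1E; apply: derive_val.
Qed.

Context d (T : measurableType d) (mu : {sigma_finite_measure set T -> \bar R}).
Variables (beta : R) (beta0 : (0 < beta)%R).

(** The Tonelli integrand: integrated over the level it gives [expR (- beta g)] on [A], integrated
    over the point it gives a weighted sublevel volume. *)
Let layer (A : set T) (g : T -> R) (z : T * measurableTypeR R) : \bar R :=
  (beta * expR (- (beta * z.2)) * \1_[set z | A z.1 /\ (g z.1 <= z.2)%R] z)%:E.

Let layer_ge0 A g z : 0 <= layer A g z.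
Proof. by rewrite lee_fin !mulr_ge0 ?expR_ge0// ltW. Qed.

Let measurable_layer A g : measurable A -> measurable_fun setT g ->
  measurable_fun setT (layer A g).
Proof.
move=> mA mg; apply/measurable_EFinP; apply: measurable_funM.
  apply: measurable_funM => //; apply: measurableT_comp => //.
  by apply: measurableT_comp => //; apply: measurable_funM.
apply: measurable_indic; apply: measurableI.
  by rewrite -[X in measurable X]setTI; exact: measurable_fst.
have := @measurable_fun_ler _ _ _ setT (g \o fst : T * measurableTypeR R -> R) snd
  (measurableT_comp mg measurable_fst) measurable_snd measurableT [set true].
by rewrite setTI; apply.
Qed.

Let integral_layer_snd A g x :
  \int[leb]_s layer A g (x, s) = (expR (- (beta * g x)) * \1_A x)%:E.
Proof.
rewrite indicE; have [xA|xA] := boolP (x \in A).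
  rewrite mulr1 -integral_expR_tail// [RHS]integral_mkcond.
  apply: eq_integral => s _; rewrite patchE /layer indicE.
  have -> : ((x, s) \in [set z | A z.1 /\ (g z.1 <= z.2)%R]) = (s \in `[g x, +oo[).
    rewrite in_itv/= andbT; apply/idP/idP => [/set_mem[]//|gs].
    by apply/mem_set; split => //=; exact: set_mem.
  by rewrite mem_setE; case: ifPn => _; rewrite ?mulr1 ?mulr0.
rewrite mulr0; apply: integral0_eq => s _; rewrite /layer indicE memNset ?mulr0//=.
by move=> [Ax _]; move: xA; rewrite mem_set.
Qed.

Let integral_layer_fst A g s : measurable A -> measurable_fun setT g ->
  \int[mu]_x layer A g (x, s) =
  (beta * expR (- (beta * s)))%:E * mu (A `&` [set x | (g x <= s)%R]).
Proof.
move=> mA mg; have mgs : measurable (A `&` [set x | (g x <= s)%R]).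
  apply: measurableI => //.
  by rewrite -[X in measurable X]setTI; exact: (measurable_fun_le _ mg).
rewrite -[A `&` _ in RHS]setIT -integral_indic// -ge0_integralZl//.
  by apply/measurable_EFinP; exact: measurable_indic.
by rewrite lee_fin mulr_ge0 ?expR_ge0// ltW.
Qed.

(** Both integrals are averages of sublevel volumes with the same weight [beta expR (- beta s)], so
    a comparison level by level suffices. *)
Lemma layer_cake_expR_le (A B : set T) (g h : T -> R) (k : R) : (0 <= k)%R ->
  measurable A -> measurable B ->
  measurable_fun setT g -> measurable_fun setT h ->
  (forall s, mu (A `&` [set x | (g x <= s)%R]) <=
             k%:E * mu (B `&` [set x | (h x <= s)%R])) ->
  \int[mu]_(x in A) (expR (- (beta * g x)))%:E <=
  k%:E * \int[mu]_(x in B) (expR (- (beta * h x)))%:E.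
Proof.
move=> k0 mA mB mg mh gh.
have cake C f : measurable C -> measurable_fun setT f ->
    \int[mu]_(x in C) (expR (- (beta * f x)))%:E =
    \int[leb]_s \int[mu]_x layer C f (x, s).
  move=> mC mf; rewrite -fubini_tonelli//; last exact: measurable_layer.
  rewrite integral_mkcond; apply: eq_integral => x _.
  rewrite integral_layer_snd patchE indicE.
  by case: ifPn => _; rewrite ?mulr1 ?mulr0.
rewrite !cake// -ge0_integralZl//; last 2 first.
- by apply: measurable_fun_fubini_tonelli_G => //; exact: measurable_layer.
- by move=> s _; exact: integral_ge0.
apply: ge0_le_integral => //.
- by move=> s _; exact: integral_ge0.
- by apply: measurable_fun_fubini_tonelli_G => //; exact: measurable_layer.
- apply: measurable_funeM.
  by apply: measurable_fun_fubini_tonelli_G => //; exact: measurable_layer.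
move=> s _; rewrite !integral_layer_fst// muleCA lee_wpmul2l//.
by rewrite lee_fin mulr_ge0 ?expR_ge0// ltW.
Qed.

End exponential_layer_cake.

(** * Volumes of balls and shells *)

Section ball_volume.
Context {R : realType}.
Implicit Types (r s x y : R) (p : nat).

Local Notation ball2 p s := [set x : 'rV[R]_p | norm2 x <= s].

Lemma measurable_norm2_le p s : measurable (ball2 p s).
Proof.
rewrite -[X in measurable X]setTI.
exact: (measurable_fun_le measurableT measurable_norm2).
Qed.

Lemma measurable_norm2_ge p s : measurable [set x : 'rV[R]_p | s <= norm2 x].
Proof.
rewrite -[X in measurable X]setTI.
by apply: (measurable_fun_le measurableT _ measurable_norm2).
Qed.

Lemma lebesgue_rV_ball p s : 0 < s ->
  lebesgue_rV p (ball2 p s) = ((s ^+ p)%:E * lebesgue_rV p (ball2 p 1%R))%E.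
Proof.
move=> s0; rewrite -lebesgue_rV_dilate//; last exact: measurable_norm2_le.
congr lebesgue_rV; apply/seteqP; split=> x /=; rewrite norm2Z ?invr_ge0 ?(ltW s0)//;
  by rewrite mulrC ler_pdivrMr// mul1r.
Qed.

(** The ball lies in the cube of side 2. Finiteness permits subtracting volumes in the shell
    bound. *)
Lemma lebesgue_rV_unit_ball_fin p : lebesgue_rV p (ball2 p 1) \is a fin_num.
Proof.
rewrite ge0_fin_numE//.
apply: (@le_lt_trans _ _ (lebesgue_rV p
    [set x : 'rV[R]_p | forall i, `[-1, 1]%classic (x ord0 i)])).
  apply: le_measure; rewrite ?inE; first exact: measurable_norm2_le.
    exact: (measurable_box (A := fun=> `[-1, 1]%classic)).
  move=> x /= x1 i; rewrite /= in_itv/= -ler_norml.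
  exact: le_trans (coord_le_norm2 x i) x1.
rewrite (lebesgue_rV_box (A := fun=> `[-1, 1]%classic))//
  -ge0_fin_numE; last by apply: prode_ge0.
apply: prode_fin_num => i _; rewrite lebesgue_measure_itv/=.
by case: ifP.
Qed.

(** Multiplying the induction hypothesis by the mean leaves the defect [(x - y) (x^p - y^p) / 2],
    nonnegative by monotonicity of powers. *)
Lemma convex_pow x y p : 0 <= x -> 0 <= y ->
  2 * ((x + y) / 2) ^+ p <= x ^+ p + y ^+ p.
Proof.
move=> x0 y0; elim: p => [|p IH]; first by rewrite !expr0; lra.
have m0 : 0 <= (x + y) / 2 by lra.
have h := ler_wpM2l m0 IH.
suff : 0 <= (x - y) * (x ^+ p - y ^+ p) by rewrite !exprS; lra.
have [xy|/ltW yx] := leP x y.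
  by rewrite mulr_le0// subr_le0// lerXn2r.
by rewrite mulr_ge0// subr_ge0// lerXn2r.
Qed.

Lemma bernoulli_ge p x : 0 <= x <= 1 -> 1 - p%:R * (1 - x) <= x ^+ p.
Proof.
case/andP=> x0 x1; elim: p => [|p IH]; first by rewrite mul0r subr0.
rewrite exprS -natr1; apply: le_trans (ler_wpM2l x0 IH).
have : 0 <= p%:R * (1 - x) * (1 - x) by rewrite !mulr_ge0// subr_ge0.
lra.
Qed.

(* With [v] the volume of the unit ball, the shell has volume at most
   [(s ^+ p - r ^+ p / 2) v], the factor [1 / 2] leaving room for the inner
   sphere; by convexity of the power function this is at most
   [(2 s - r) ^+ p v / 2 = 2 ^+ p.-1 (s - r / 2) ^+ p v]. *)
Lemma lebesgue_rV_shell_le p r s : (0 < p)%N -> 0 <= r ->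
  (lebesgue_rV p ([set x | (r <= norm2 x)%R] `&` [set x | (norm2 x <= s)%R]) <=
   (2 ^+ p.-1)%:E * lebesgue_rV p (setT `&` [set x | (norm2 x + r / 2 <= s)%R]))%E.
Proof.
case: p => // p _ r0; rewrite [p.+1.-1]/=.
have mshell : measurable ([set x : 'rV[R]_p.+1 | r <= norm2 x] `&` ball2 p.+1 s).
  by apply: measurableI; [exact: measurable_norm2_ge|exact: measurable_norm2_le].
have -> : setT `&` [set x : 'rV[R]_p.+1 | norm2 x + r / 2 <= s] = ball2 p.+1 (s - r / 2).
  by rewrite setTI; apply/seteqP; split => x /=; rewrite lerBrDr.
have [sr|rs] := ltP s r.
  rewrite (_ : [set x | _] `&` _ = set0) ?measure0.
    by rewrite mule_ge0// lee_fin exprn_ge0.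
  by apply/seteqP; split => // x /= [rx xs]; move: (le_trans rx xs); lra.
have [r_eq0|rn0] := eqVneq r 0.
  rewrite r_eq0 mul0r subr0 in mshell *.
  apply: (@le_trans _ _ (lebesgue_rV p.+1 (ball2 p.+1 s))).
    by apply: le_measure; rewrite ?inE//; first exact: measurable_norm2_le.
  by rewrite -[leLHS]mul1e lee_wpmul2r// lee_fin exprn_ege1// ler1n.
have {rn0}r_gt0 : 0 < r by rewrite lt_neqAle eq_sym rn0.
(* The ball of radius [q r] avoids the sphere of radius [r], which belongs to the shell, and
   Bernoulli with [p.+1 u = 1 / 2] keeps [q ^+ p.+1] at least [1 / 2]. *)
pose u : R := (2 * p.+1%:R)^-1; pose q : R := 1 - u.
have /andP[u0 u2] : 0 < u <= 2^-1.
  rewrite invr_gt0 mulr_gt0//= lef_pV2 ?posrE ?mulr_gt0//.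
  by rewrite ler_peMr// ler1n.
have q01 : 0 < q < 1 by move: u0 u2; rewrite /q; clearbody u; lra.
have /andP[q0 q1] := q01.
have qp : 2^-1 <= q ^+ p.+1.
  apply: le_trans (bernoulli_ge p.+1 _); last by lra.
  have -> : p.+1%:R * (1 - q) = 2^-1.
    by rewrite /q opprB addrC subrK /u invfM mulrCA divff ?mulr1// pnatr_eq0.
  lra.
have qr0 : 0 < q * r by rewrite mulr_gt0.
have disj : ([set x : 'rV[R]_p.+1 | r <= norm2 x] `&` ball2 p.+1 s) `&`
    ball2 p.+1 (q * r) = set0.
  apply/seteqP; split => // x [[/= rx _] xq]; move: (le_trans rx xq).
  by rewrite leNgt gtr_pMl// q1.
have : (lebesgue_rV p.+1 ([set x | (r <= norm2 x)%R] `&` ball2 p.+1 s) +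
    lebesgue_rV p.+1 (ball2 p.+1 (q * r)%R) <=
    lebesgue_rV p.+1 (ball2 p.+1 s))%E.
  rewrite -measureU//; last exact: measurable_norm2_le.
  apply: le_measure; rewrite ?inE.
  - by apply: measurableU => //; exact: measurable_norm2_le.
  - exact: measurable_norm2_le.
  - move=> x [[]//|/= xq]; apply: (le_trans xq); apply: le_trans rs.
    by rewrite ger_pMl// ltW.
have s0 : 0 < s by lra.
have sr0 : 0 < s - r / 2 by lra.
rewrite (lebesgue_rV_ball _ s0) (lebesgue_rV_ball _ qr0) (lebesgue_rV_ball _ sr0).
have /fineK <- := lebesgue_rV_unit_ball_fin p.+1.
set v := fine _; have v0 : 0 <= v by rewrite fine_ge0.
rewrite -!EFinM -leeBrDr// -EFinB => /le_trans; apply.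
rewrite lee_fin mulrA exprMn.
(* [s] is the midpoint of [2 s - r] and [r]. *)
have pw : 2 * s ^+ p.+1 <= (2 * s - r) ^+ p.+1 + r ^+ p.+1.
  have := @convex_pow (2 * s - r) r p.+1.
  by rewrite subrK [2 * s]mulrC mulfK//; apply; lra.
have -> : 2 ^+ p * (s - r / 2) ^+ p.+1 = (2 * s - r) ^+ p.+1 / 2.
  have -> : 2 * s - r = 2 * (s - r / 2) by field.
  rewrite exprMn [2 ^+ p.+1]exprS; move: (_ ^+ p.+1) (2 ^+ p) => w z.
  by field.
have : 2^-1 * r ^+ p.+1 <= q ^+ p.+1 * r ^+ p.+1.
  by rewrite ler_wpM2r// exprn_ge0.
move=> qr; rewrite -mulrBl ler_wpM2r//; lra.
Qed.

End ball_volume.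

(** * Tails of the two noise distributions *)

Section noise_tails.
Context {R : realType} {p : nat} d (Om : measurableType d) (P : probability Om R).
Variable b : {RV P >-> 'rV[R]_p}.

Lemma density_norm2_ge (g : 'rV[R]_p -> R) (r : R) : has_density b g ->
  P [set omega | r <= norm2 (b omega)] =
  (\int[lebesgue_rV p]_(x in [set x | (r <= norm2 x)%R]) (g x)%:E)%E.
Proof. by move=> <- //; exact: measurable_norm2_ge. Qed.

Lemma integral_density (g : 'rV[R]_p -> R) : has_density b g ->
  (\int[lebesgue_rV p]_x (g x)%:E = 1)%E.
Proof. by move=> <- //; rewrite /distribution /pushforward/= probability_setT. Qed.

(** The total mass 1 is inserted on the right, so the normalizing constant [c] cancels. Layer cake
    compares [norm2] on the tail with [norm2 + r / 2] on the whole space; the shift produces the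
    exponential factor. *)
Lemma gamma_noise_tail (beta r : R) : (0 < p)%N -> 0 < beta -> 0 <= r ->
  has_density_propto b (fun x => expR (- (beta * norm2 x))) ->
  (P [set omega | (r <= norm2 (b omega))%R] <=
   (2 ^+ p.-1 * expR (- (beta * r / 2)))%:E)%E.
Proof.
move=> p0 beta0 r0 [c c0 dens].
rewrite (density_norm2_ge _ dens) -[leRHS]mule1 -(integral_density dens).
have mexp (f : 'rV[R]_p -> R) : measurable_fun setT f ->
    measurable_fun setT (fun x => (expR (- (beta * f x)))%:E).
  move=> mf; apply/measurable_EFinP; apply: measurableT_comp => //.
  by apply: measurableT_comp => //; apply: measurable_funM.
under eq_integral do rewrite EFinM.
under [X in (_ <= _ * X)%E]eq_integral do rewrite EFinM.
have mn := mexp _ measurable_norm2.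
rewrite ge0_integralZl//; last 3 first.
- exact: measurable_norm2_ge.
- exact: measurable_funTS mn.
- by rewrite lee_fin ltW.
rewrite ge0_integralZl//; last by rewrite lee_fin ltW.
rewrite muleCA lee_wpmul2l ?lee_fin ?(ltW c0)//.
have shift : (\int[lebesgue_rV p]_x (expR (- (beta * (norm2 x + r / 2))))%:E =
    (expR (- (beta * r / 2)))%:E *
    \int[lebesgue_rV p]_x (expR (- (beta * norm2 x)))%:E)%E.
  rewrite -ge0_integralZl//.
  apply: eq_integral => x _; rewrite -EFinM -expRD; congr (expR _)%:E.
  by rewrite mulrDr opprD addrC mulrA.
rewrite EFinM -muleA -shift.
apply: layer_cake_expR_le => //.
- exact: measurable_norm2_ge.
- exact: measurable_norm2.
- by apply: measurable_funD => //; exact: measurable_norm2.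
by move=> s; exact: lebesgue_rV_shell_le.
Qed.

(* Exponential tilting: the tilted density is a dilated Gaussian density, with the
   optimal dilation factor [q = r / (sigma * sqrt p)]. *)
Lemma gaussian_noise_tail (sigma r : R) : (0 < p)%N -> 0 < sigma ->
  sigma * Num.sqrt p%:R <= r -> has_density b (gaussian_pdf sigma) ->
  (P [set omega | (r <= norm2 (b omega))%R] <=
   (expR (- ((r - sigma * Num.sqrt p%:R) ^+ 2 / (2 * sigma ^+ 2))))%:E)%E.
Proof.
move=> p0 sigma0 rp dens.
set w := Num.sqrt p%:R in rp *.
have w0 : 0 < w by rewrite sqrtr_gt0 ltr0n.
have w2 : w ^+ 2 = p%:R by rewrite sqr_sqrtr.
have r0 : 0 <= r by apply: le_trans rp; rewrite mulr_ge0 ?ltW.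
have sw0 : 0 < sigma * w by rewrite mulr_gt0.
have [q rE] : exists q, r = q * (sigma * w).
  by exists (r / (sigma * w)); rewrite divfK// gt_eqF.
have q1 : 1 <= q by rewrite -(ler_pM2r sw0) mul1r -rE.
have q0 : 0 < q by lra.
(* The largest ratio of the density at [x] to that at [q^-1 x] for [norm2 x >= r], taken at
   [norm2 x = r]. *)
pose k := expR (- ((q ^+ 2 - 1) * p%:R / 2)).
have k0 : 0 <= k by exact: expR_ge0.
have mg : measurable_fun setT (fun x : 'rV[R]_p => (gaussian_pdf sigma x)%:E).
  apply/measurable_EFinP; apply: measurable_funM => //.
  apply: measurableT_comp => //; apply: measurableT_comp => //.
  apply: measurable_funM => //; apply: measurable_funX; exact: measurable_norm2.
have g0 x : 0 <= @gaussian_pdf R p sigma x.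
  by rewrite mulr_ge0 ?expR_ge0// invr_ge0 exprn_ge0// sqrtr_ge0.
have mgq : measurable_fun setT (fun x : 'rV[R]_p => (gaussian_pdf sigma (q^-1 *: x))%:E).
  exact: (measurableT_comp mg (measurable_scale_rV q^-1)).
rewrite (density_norm2_ge _ dens).
apply: (@le_trans _ _ (\int[lebesgue_rV p]_x
    (k%:E * (gaussian_pdf sigma (q^-1 *: x))%:E))%E).
  apply: (@le_trans _ _ (\int[lebesgue_rV p]_(x in [set x | (r <= norm2 x)%R])
      (k%:E * (gaussian_pdf sigma (q^-1 *: x))%:E))%E).
    apply: ge0_le_integral.
    - exact: measurable_norm2_ge.
    - by move=> x _; rewrite lee_fin.
    - exact: measurable_funTS mg.
    - by apply: measurable_funeM; exact: measurable_funTS mgq.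
    move=> x /= rx; rewrite -EFinM lee_fin /gaussian_pdf [leRHS]mulrCA ler_wpM2l//.
    rewrite -expRD ler_expR norm2Z ?invr_ge0 ?(ltW q0)//.
    have rx2 : (q * (sigma * w)) ^+ 2 <= norm2 x ^+ 2.
      by rewrite -rE ler_sqr ?nnegrE ?norm2_ge0.
    rewrite 2!exprMn w2 in rx2; rewrite -subr_ge0.
    have -> : - ((q ^+ 2 - 1) * p%:R / 2) -
        (q^-1 * norm2 x) ^+ 2 / (2 * sigma ^+ 2) -
        - (norm2 x ^+ 2 / (2 * sigma ^+ 2)) =
        (q ^+ 2 - 1) * (norm2 x ^+ 2 - q ^+ 2 * (sigma ^+ 2 * p%:R)) /
        (2 * sigma ^+ 2 * q ^+ 2).
      by field; rewrite !gt_eqF.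
    apply: divr_ge0; last by rewrite !mulr_ge0// ltW.
    by rewrite mulr_ge0 ?subr_ge0// exprn_ege1.
  apply: ge0_subset_integral => //; first exact: measurable_norm2_ge.
    by apply: measurable_funeM.
  by move=> x _; rewrite mule_ge0 ?lee_fin.
rewrite ge0_integralZl//; last by move=> x _; rewrite lee_fin.
rewrite (ge0_integral_dilate q0 mg) => [|x]; last by rewrite lee_fin.
rewrite (integral_density dens) mule1 -EFinM lee_fin.
(* The dilation costs [q ^+ p <= expR (p (q - 1))]; the total exponent becomes
   [- p (q - 1)^2 / 2]. *)
apply: (@le_trans _ _ (k * expR (p%:R * (q - 1)))).
  rewrite ler_wpM2l// expRM_natl lerXn2r ?nnegrE ?expR_ge0 ?(ltW q0)//.
  by apply: le_trans (expR_ge1Dx _); rewrite subrKC.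
rewrite -expRD ler_expR rE.
have -> : (q * (sigma * w) - sigma * w) ^+ 2 / (2 * sigma ^+ 2) =
    p%:R * (q - 1) ^+ 2 / 2.
  by rewrite -w2; field; rewrite gt_eqF.
lra.
Qed.

End noise_tails.

(** * The constant of the gamma tail, and assembly of the bounds *)

Lemma gamma_tail_const_ge {R : realType} (p : nat) : (0 < p)%N ->
  2 ^+ p.-1 <= @gamma_tail_const R p.
Proof.
case: p => // -[|k] _; first by rewrite /gamma_tail_const expr0.
rewrite /gamma_tail_const /=; set K : R := k.+1%:R.
have K0 : 0 < K by rewrite ltr0n.
(* With [K = p - 1], the constant is [2^K K^K / expR (K - 1)]. The inverse of this inequality is
   [1 + (K^-1 - 1) <= expR (K^-1 - 1)], and its [K]-th power gives [eKK]. *)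
have eK : expR (1 - K^-1) <= K.
  rewrite -lef_pV2 ?posrE ?expR_gt0// -expRN opprB.
  by apply: le_trans (expR_ge1Dx _); rewrite subrKC.
have eKK : expR (K - 1) <= K ^+ k.+1.
  have -> : K - 1 = K * (1 - K^-1) by rewrite mulrBr mulr1 divff// gt_eqF.
  by rewrite expRM_natl lerXn2r ?nnegrE ?expR_ge0 ?(ltW K0).
have -> : expR 1 * (2 * K / expR 1) ^+ k.+1 =
    2 ^+ k.+1 * (K ^+ k.+1 / expR (K - 1)).
  rewrite expRB -(mulr1 K) expRM_natl mulr1 !exprMn exprVn.
  by rewrite invf_div; field; rewrite !gt_eqF ?expR_gt0 ?exprn_gt0 ?expR_gt0.
by rewrite ler_peMr ?exprn_ge0// ler_pdivlMr ?expR_gt0// mul1r.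
Qed.

Theorem theorem3p5 (R : realType) (X : Type) (n p m : nat)
    (n_gt0 : (0 < n)%N) (p_gt0 : (0 < p)%N)
    (Xi : set 'rV[R]_m) (Xi_closed : closed Xi) (Xi_convex : convex_set Xi)
    (F : {fun Xi >-> scaled_simplex R n})
    (E : 'rV[R]_m -> n.-tuple X -> R)
    (E_convex : forall D, convex_function Xi (E^~ D))
    (Theta : set 'rV[R]_p) (Theta_closed : closed Theta)
    (Theta_convex : convex_set Theta)
    (reg : 'rV[R]_p -> R) (reg_convex : convex_function setT reg)
    (ell : 'rV[R]_p -> X -> R)
    (ell_convex : forall d, convex_function setT (ell^~ d))
    (ell_C2 : forall d, continuous_hessian (ell^~ d))
    (D : n.-tuple X)
    (lambda_star : 'rV[R]_m) (lambda_star_min : argmin Xi (E^~ D) lambda_star)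
    (L := erm_objective ell reg (F lambda_star) D)
    (rho : R) (rho_ge0 : 0 <= rho) (L_convex : strongly_convex rho L)
    (theta_opt : 'rV[R]_p) (theta_opt_min : argmin Theta L theta_opt)
    (gamma : R) (gamma_gt0 : 0 < gamma)
    (dOm : measure_display) (Om : measurableType dOm) (P : probability Om R)
    (b : {RV P >-> 'rV[R]_p})
    (theta_priv := private_minimizer n Theta L gamma)
    (a0 := norm2 theta_opt)
    (C := bound_C rho gamma a0) (Dt := bound_D rho gamma a0)
    (failure := fun t : R =>
       [set omega | L theta_opt + t <= L (theta_priv (b omega))]) :
  [/\ forall t : R, C <= t ->
        (P (failure t) <= P [set omega | (n%:R * Dt t <= norm2 (b omega))%R])%E,
      forall beta : R, 0 < beta ->
        has_density_propto b (fun x => expR (- (beta * norm2 x))) ->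
        forall t : R, C <= t ->
        (P (failure t) <=
           (gamma_tail_const p * expR (- (beta * n%:R * Dt t / 2)))%:E)%E
    & forall sigma : R, 0 < sigma ->
        has_density b (gaussian_pdf sigma) ->
        forall t : R, C <= t ->
        (P (failure t) <=
           (2 * expR (- (1 / (2 * sigma ^+ 2) *
              Num.max (n%:R * Dt t - sigma * Num.sqrt p%:R) 0 ^+ 2)))%:E)%E].
Proof.
have L_continuous : continuous L.
  by apply: convex_continuous; exact: strongly_convexW L_convex.
have measurable_ge (g : 'rV[R]_p -> R) r : measurable_fun setT g ->
    measurable [set omega | r <= g (b omega)].
  move=> mg; rewrite -[X in measurable X]setTI; apply: measurable_fun_le => //.
  exact: (measurableT_comp mg (measurable_funPT b)).
(* The event is a superlevel set of [L \o theta_priv] at the noise, and this composite is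
   continuous. *)
have failure_measurable t : measurable (failure t).
  apply: (measurable_ge (L \o theta_priv)); apply: continuous_measurable_rV => x.
  apply: continuous_comp; last exact: L_continuous.
  exact: (private_minimizer_continuous n_gt0 rho_ge0 gamma_gt0 Theta_closed
    Theta_convex L_convex theta_opt_min).
have failure_le t : C <= t ->
    (P (failure t) <= P [set omega | (n%:R * Dt t <= norm2 (b omega))%R])%E.
  move=> Ct; apply: le_measure; rewrite ?inE//.
    exact: measurable_ge measurable_norm2.
  move=> omega; exact: (failure_noise_ge n_gt0 rho_ge0 gamma_gt0 Theta_closed
    Theta_convex L_convex theta_opt_min).
have D_ge0 t : C <= t -> 0 <= n%:R * Dt t.
  by move=> Ct; rewrite mulr_ge0// bound_D_ge0 ?norm2_ge0// ltW.
split=> // [beta beta_gt0 dens t Ct|sigma sigma_gt0 dens t Ct].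
  apply: le_trans (failure_le t Ct) _.
  apply: le_trans (gamma_noise_tail p_gt0 beta_gt0 (D_ge0 t Ct) dens) _.
  by rewrite lee_fin !mulrA ler_wpM2r ?expR_ge0 ?gamma_tail_const_ge.
apply: le_trans (failure_le t Ct) _.
(* Below the threshold [sigma sqrt p] the positive part vanishes and the bound is 2, which exceeds
   any probability. *)
have [sn|/ltW ns] := leP (sigma * Num.sqrt p%:R) (n%:R * Dt t); last first.
  apply: (@le_trans _ _ 1%E).
    by apply: probability_le1; exact: measurable_ge measurable_norm2.
  by rewrite max_r ?subr_le0// expr0n/= mulr0 oppr0 expR0 mulr1 lee_fin ler1n.
apply: le_trans (gaussian_noise_tail p_gt0 sigma_gt0 sn dens) _.
rewrite max_l ?subr_ge0// lee_fin div1r [_^-1 * _]mulrC.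
by rewrite ler_peMl ?expR_ge0// ler1n.
Qed.
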